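(* Let $C$ be a coalgebra over a field $k$, and let $\Lambda\in\mathcal{M}^C$ be a quasi-finite and injective right $C$-comodule. Then $\mathrm{e}_C(\Lambda)\simeq\Lambda\square_C\mathrm{h}_C(\Lambda,C)$ as $k$-coalgebras.
   Context: $\mathcal M^C$ is the category of right $C$-comodules. $\Lambda$ is quasi-finite if $-\otimes_k\Lambda:\mathcal M_k\to\mathcal M^C$ has a left adjoint $\mathrm h_C(\Lambda,-)$ (cohom functor); let $\theta_M:M\to\mathrm h_C(\Lambda,M)\otimes_k\Lambda$ be the unit. $\mathrm e_C(\Lambda)=\mathrm h_C(\Lambda,\Lambda)$ is a $k$-coalgebra with $\Delta_e,\epsilon_e$ the unique linear maps with $(\Delta_e\otimes\Lambda)\theta_\Lambda=(\mathrm e_C(\Lambda)\otimes\theta_\Lambda)\theta_\Lambda$ and $(\epsilon_e\otimes\Lambda)\theta_\Lambda=1_\Lambda$. $X=\mathrm h_C(\Lambda,C)$ is a left $C$-comodule via $\mathrm h_C(\Lambda,\Delta_C):X\to\mathrm h_C(\Lambda,C\otimes C)\simeq C\otimes X$. $M\square_CN=\ker(\rho_M\otimes N-M\otimes\lambda_N)\subset M\otimes N$. When $\Lambda$ is quasi-finite injective, $-\square_CX\simeq\mathrm h_C(\Lambda,-)$ is left adjoint to $-\otimes_k\Lambda$, with unit $M\simeq M\square_CC\xrightarrow{M\square\theta_C}M\square_CX\otimes\Lambda$ and counit at $V\in\mathcal M_k$ equal to $V\otimes\omega$ for a unique linear map $\omega:\Lambda\square_CX\to k$. $\Lambda\square_CX$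 is a $k$-coalgebra with coproduct $\Lambda\square_CX\simeq\Lambda\square_CC\square_CX\xrightarrow{\Lambda\square\theta_C\square X}(\Lambda\square_CX)\otimes(\Lambda\square_CX)$ and counit $\omega$. *)

(* Defs.v *)
From HB Require Import structures.
From mathcomp Require Import all_boot all_order all_algebra.
From mathcomp Require Import generic_quotient sesquilinear.
From mathcomp Require Import boolp.

Set Implicit Arguments.
Unset Strict Implicit.
Unset Printing Implicit Defensive.

Import GRing.Theory.
Local Open Scope ring_scope.
Local Open Scope quotient_scope.

Section Tensor.
Variables (k : fieldType) (V W : lmodType k).

Definition tsum (U : lmodType k) (f : V -> W -> U) (s : seq (V * W)) : U :=
  \sum_(p <- s) f p.1 p.2.

(* A list stands for the sum of its elementary tensors.  Two lists are
   identified when no bilinear map separates them. *)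
Definition tens_rel (s t : seq (V * W)) : bool :=
  `[< forall (U : lmodType k) (f : {bilinear V -> W -> U}),
        tsum f s = tsum f t >].

Lemma tens_rel_refl : reflexive tens_rel.
Proof. by move=> s; apply/asboolP. Qed.
Lemma tens_rel_sym : symmetric tens_rel.
Proof. by move=> s t; apply/asboolP/asboolP=> h U f; rewrite h. Qed.
Lemma tens_rel_trans : transitive tens_rel.
Proof. by move=> t s u /asboolP h /asboolP h'; apply/asboolP=> U f; rewrite h h'. Qed.

Canonical tens_equiv := EquivRel tens_rel tens_rel_refl tens_rel_sym tens_rel_trans.

Definition tens := {eq_quot tens_equiv}.
HB.instance Definition _ := Choice.on tens.
HB.instance Definition _ := EqQuotient.on tens.

Lemma tensP (s t : seq (V * W)) :
  (forall (U : lmodType k) (f : {bilinear V -> W -> U}), tsum f s = tsum f t) ->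
  \pi_tens s = \pi_tens t.
Proof. by move=> h; apply/eqmodP/asboolP. Qed.

Lemma tsum_repr (U : lmodType k) (f : {bilinear V -> W -> U}) s :
  tsum f (repr (\pi_tens s)) = tsum f s.
Proof.
have /eqmodP/asboolP h : repr (\pi_tens s) = s %[mod tens] by rewrite reprK.
exact: h.
Qed.

Lemma tsum_cat (U : lmodType k) (f : V -> W -> U) s t :
  tsum f (s ++ t) = tsum f s + tsum f t.
Proof. exact: big_cat. Qed.

Definition tscale_seq (a : k) (s : seq (V * W)) := [seq (a *: p.1, p.2) | p <- s].

Lemma tsum_scale (U : lmodType k) (f : {bilinear V -> W -> U}) a s :
  tsum f (tscale_seq a s) = a *: tsum f s.
Proof.
rewrite /tsum big_map scaler_sumr; apply: eq_bigr => p _ /=.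
exact: (linearl_subproof p.2 a p.1).
Qed.

Definition tens0 : tens := \pi_tens [::].
Definition tens_add (x y : tens) : tens := \pi_tens (repr x ++ repr y).
Definition tens_scale (a : k) (x : tens) : tens := \pi_tens (tscale_seq a (repr x)).
Definition tens_opp (x : tens) : tens := tens_scale (-1) x.

Lemma tens_addA : associative tens_add.
Proof. by move=> x y z; apply: tensP => U f; rewrite !(tsum_cat, tsum_repr) addrA. Qed.
Lemma tens_addC : commutative tens_add.
Proof. by move=> x y; apply: tensP => U f; rewrite !tsum_cat addrC. Qed.
Lemma tens_add0 : left_id tens0 tens_add.
Proof.
move=> x; rewrite -[RHS]reprK; apply: tensP => U f.
by rewrite tsum_cat tsum_repr /tsum big_nil add0r.
Qed.
Lemma tens_addN : left_inverse tens0 tens_opp tens_add.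
Proof.
move=> x; apply: tensP => U f.
by rewrite tsum_cat tsum_repr tsum_scale scaleN1r addNr /tsum big_nil.
Qed.

HB.instance Definition _ :=
  GRing.isZmodule.Build tens tens_addA tens_addC tens_add0 tens_addN.

Lemma tens_scaleA a b x : tens_scale a (tens_scale b x) = tens_scale (a * b) x.
Proof. by apply: tensP => U f; rewrite tsum_scale tsum_repr !tsum_scale scalerA. Qed.
Lemma tens_scale1 : left_id 1 tens_scale.
Proof.
by move=> x; rewrite -[RHS]reprK; apply: tensP => U f; rewrite tsum_scale scale1r.
Qed.
Lemma tens_scaleDr : right_distributive tens_scale +%R.
Proof.
move=> a x y; apply: tensP => U f.
by rewrite tsum_cat !(tsum_scale, tsum_repr) tsum_cat scalerDr.
Qed.
Lemma tens_scaleDl x : {morph tens_scale^~ x : a b / a + b}.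
Proof.
move=> a b; apply: tensP => U f.
by rewrite tsum_cat !(tsum_scale, tsum_repr) scalerDl.
Qed.

HB.instance Definition _ := GRing.Zmodule_isLmodule.Build k tens
  tens_scaleA tens_scale1 tens_scaleDr tens_scaleDl.

Definition pure (v : V) (w : W) : tens := \pi_tens [:: (v, w)].

Lemma tens_addE (x y : tens) : x + y = \pi_tens (repr x ++ repr y).
Proof. by []. Qed.
Lemma tens_scaleE a (x : tens) : a *: x = \pi_tens (tscale_seq a (repr x)).
Proof. by []. Qed.

Lemma pure_is_bilinear : bilinear_for *:%R *:%R pure.
Proof.
split=> [w a v v'|v a w w']; apply: tensP => U f.
  rewrite tsum_cat !tsum_repr tsum_scale tsum_repr /tsum !big_seq1 /=.
  by rewrite linearDl linearZl_LR.
rewrite tsum_cat !tsum_repr tsum_scale tsum_repr /tsum !big_seq1 /=.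
by rewrite linearDr linearZr_LR.
Qed.
HB.instance Definition _ := bilinear_isBilinear.Build k V W tens *:%R *:%R pure
  pure_is_bilinear.

HB.instance Definition _ v := GRing.isLinear.Build k W tens *:%R (pure v)
  (pure_is_bilinear.2 v).

Lemma tens_sum_pure (x : tens) : x = \sum_(p <- repr x) pure p.1 p.2.
Proof.
rewrite -{1}[x]reprK; elim: (repr x) => [|p s IH]; first by rewrite big_nil.
rewrite big_cons -IH tens_addE; apply: tensP => U f.
by rewrite tsum_cat !tsum_repr /tsum big_cons big_seq1.
Qed.

Section Lift.
Variables (U : lmodType k) (f : {bilinear V -> W -> U}).
Definition tlift (x : tens) : U := tsum f (repr x).
Lemma tlift_is_linear : linear tlift.
Proof.
move=> a x y; rewrite /tlift tens_addE tens_scaleE.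
by rewrite tsum_repr tsum_cat tsum_repr tsum_scale.
Qed.
HB.instance Definition _ := GRing.isLinear.Build k tens U *:%R tlift tlift_is_linear.
Lemma tliftE v w : tlift (pure v w) = f v w.
Proof. by rewrite /tlift tsum_repr /tsum big_seq1. Qed.
End Lift.

Lemma tlift_linear (U : lmodType k) a (f g h : {bilinear V -> W -> U}) x :
  (forall v w, h v w = a *: f v w + g v w) ->
  tlift h x = a *: tlift f x + tlift g x.
Proof.
by move=> e; rewrite /tlift /tsum scaler_sumr -big_split; apply: eq_bigr => p _ /=.
Qed.

Lemma tens_ext (U : lmodType k) (f g : {linear tens -> U}) :
  (forall v w, f (pure v w) = g (pure v w)) -> f =1 g.
Proof.
move=> h x; rewrite [x]tens_sum_pure !linear_sum.
by apply: eq_bigr => p _; rewrite h.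
Qed.

End Tensor.


Notation "V ⊗ W" := (tens V W) (at level 40, left associativity) : type_scope.

(* Below, [tmap f g] is f ⊗ g and [idl V] is the identity of V. *)
Section TensorMaps.
Variable k : fieldType.
Implicit Types U V W : lmodType k.

Definition idl V : {linear V -> V} := idfun.

Section Map.
Variables (V V' W W' : lmodType k).
Variables (f : {linear V -> V'}) (g : {linear W -> W'}).
Definition tmap_fun v w := pure (f v) (g w).
Lemma tmap_fun_bilinear : bilinear_for *:%R *:%R tmap_fun.
Proof.
by split=> [w a v v'|v a w w']; rewrite /tmap_fun linearP;
  [rewrite linearDl linearZl_LR | rewrite linearDr linearZr_LR].
Qed.
HB.instance Definition _ := bilinear_isBilinear.Build k V W (V' ⊗ W') *:%R *:%R
  tmap_fun tmap_fun_bilinear.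
Definition tmap : {linear V ⊗ W -> V' ⊗ W'} := tlift tmap_fun.
Lemma tmapE v w : tmap (pure v w) = pure (f v) (g w).
Proof. exact: tliftE. Qed.
End Map.

Section Assoc.
Variables (U V W : lmodType k).
Definition tassoc_in (w : W) (u : U) (v : V) : U ⊗ (V ⊗ W) := pure u (pure v w).
Lemma tassoc_in_bilinear w : bilinear_for *:%R *:%R (tassoc_in w).
Proof.
split=> [v a u u'|u a v v']; rewrite /tassoc_in.
  by rewrite linearDl linearZl_LR.
by rewrite linearDl linearZl_LR linearDr linearZr_LR.
Qed.
HB.instance Definition _ w := bilinear_isBilinear.Build k U V (U ⊗ (V ⊗ W))
  *:%R *:%R (tassoc_in w) (tassoc_in_bilinear w).
Definition tassoc_fun (x : U ⊗ V) (w : W) := tlift (tassoc_in w) x.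
Lemma tassoc_fun_bilinear : bilinear_for *:%R *:%R tassoc_fun.
Proof.
split=> [w a x y|x a w w']; rewrite /tassoc_fun; first exact: linearP.
apply: tlift_linear => u v.
by rewrite /= /tassoc_in linearDr linearZr_LR linearDr linearZr_LR.
Qed.
HB.instance Definition _ := bilinear_isBilinear.Build k (U ⊗ V) W (U ⊗ (V ⊗ W))
  *:%R *:%R tassoc_fun tassoc_fun_bilinear.
Definition tassoc : {linear (U ⊗ V) ⊗ W -> U ⊗ (V ⊗ W)} := tlift tassoc_fun.
Lemma tassocE u v w : tassoc (pure (pure u v) w) = pure u (pure v w).
Proof. by transitivity (tassoc_fun (pure u v) w); exact: tliftE. Qed.

Definition tassocV_in (u : U) (v : V) (w : W) : (U ⊗ V) ⊗ W := pure (pure u v) w.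
Lemma tassocV_in_bilinear u : bilinear_for *:%R *:%R (tassocV_in u).
Proof.
split=> [w a v v'|v a w w']; rewrite /tassocV_in.
  by rewrite linearDr linearZr_LR linearDl linearZl_LR.
by rewrite linearDr linearZr_LR.
Qed.
HB.instance Definition _ u := bilinear_isBilinear.Build k V W ((U ⊗ V) ⊗ W)
  *:%R *:%R (tassocV_in u) (tassocV_in_bilinear u).
Definition tassocV_fun (u : U) (x : V ⊗ W) := tlift (tassocV_in u) x.
Lemma tassocV_fun_bilinear : bilinear_for *:%R *:%R tassocV_fun.
Proof.
split=> [x a u u'|u a x y]; rewrite /tassocV_fun; last exact: linearP.
apply: tlift_linear => v w.
by rewrite /= /tassocV_in linearDl linearZl_LR linearDl linearZl_LR.
Qed.
HB.instance Definition _ := bilinear_isBilinear.Build k U (V ⊗ W) ((U ⊗ V) ⊗ W)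
  *:%R *:%R tassocV_fun tassocV_fun_bilinear.
Definition tassocV : {linear U ⊗ (V ⊗ W) -> (U ⊗ V) ⊗ W} := tlift tassocV_fun.
Lemma tassocVE u v w : tassocV (pure u (pure v w)) = pure (pure u v) w.
Proof. by transitivity (tassocV_fun u (pure v w)); exact: tliftE. Qed.
End Assoc.

Section Unitors.
Variable V : lmodType k.
Definition tlid_fun (a : k^o) (v : V) : V := (a : k) *: v.
Lemma tlid_fun_bilinear : bilinear_for *:%R *:%R tlid_fun.
Proof.
split=> [v a b c|b a v w]; rewrite /tlid_fun.
  by rewrite -[LHS]/((a * b + c : k) *: v) scalerDl -scalerA.
by rewrite -[RHS]/(a *: ((b : k) *: v) + (b : k) *: w) scalerDr !scalerA mulrC.
Qed.
HB.instance Definition _ := bilinear_isBilinear.Build k k^o V V *:%R *:%R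
  tlid_fun tlid_fun_bilinear.
Definition tlid : {linear k^o ⊗ V -> V} := tlift tlid_fun.
Lemma tlidE (a : k^o) v : tlid (pure a v) = (a : k) *: v.
Proof. exact: tliftE. Qed.

Definition tlidV_fun (v : V) : k^o ⊗ V := @pure k k^o V 1 v.
Lemma tlidV_is_linear : linear tlidV_fun.
Proof. by move=> a v w; rewrite /tlidV_fun linearDr linearZr_LR. Qed.
HB.instance Definition _ := GRing.isLinear.Build k V (k^o ⊗ V) *:%R tlidV_fun
  tlidV_is_linear.
Definition tlidV : {linear V -> k^o ⊗ V} := tlidV_fun.

Definition trid_fun (v : V) (a : k^o) : V := (a : k) *: v.
Lemma trid_fun_bilinear : bilinear_for *:%R *:%R trid_fun.
Proof.
split=> [b a v w|v a b c]; rewrite /trid_fun.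
  by rewrite -[RHS]/(a *: ((b : k) *: v) + (b : k) *: w) scalerDr !scalerA mulrC.
by rewrite -[LHS]/((a * b + c : k) *: v) scalerDl -scalerA.
Qed.
HB.instance Definition _ := bilinear_isBilinear.Build k V k^o V *:%R *:%R
  trid_fun trid_fun_bilinear.
Definition trid : {linear V ⊗ k^o -> V} := tlift trid_fun.
Lemma tridE v (a : k^o) : trid (pure v a) = (a : k) *: v.
Proof. exact: tliftE. Qed.
End Unitors.

Arguments tassoc {U V W}.
Arguments tassocV {U V W}.
Arguments tlid {V}.
Arguments tlidV {V}.
Arguments trid {V}.

Lemma tens_ext3 U V W (Z : lmodType k) (f g : {linear (U ⊗ V) ⊗ W -> Z}) :
  (forall u v w, f (pure (pure u v) w) = g (pure (pure u v) w)) -> f =1 g.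
Proof.
move=> h; apply: tens_ext => x w; rewrite [x]tens_sum_pure linear_sumlz !linear_sum.
by apply: eq_bigr => p _; rewrite h.
Qed.


Lemma tens_ext3V U V W (Z : lmodType k) (f g : {linear U ⊗ (V ⊗ W) -> Z}) :
  (forall u v w, f (pure u (pure v w)) = g (pure u (pure v w))) -> f =1 g.
Proof.
move=> h; apply: tens_ext => u x; rewrite [x]tens_sum_pure linear_sumr !linear_sum.
by apply: eq_bigr => p _; rewrite h.
Qed.

Lemma eq_tmap V V' W W' (f f' : {linear V -> V'}) (g g' : {linear W -> W'}) :
  f =1 f' -> g =1 g' -> tmap f g =1 tmap f' g'.
Proof. by move=> ef eg; apply: tens_ext => v w; rewrite !tmapE ef eg. Qed.

Lemma tmap_id V W x : tmap (idl V) (idl W) x = x.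
Proof.
by apply: (tens_ext (f := tmap _ _) (g := idl _)) => v w; rewrite tmapE.
Qed.

Lemma tmap_comp V V' V'' W W' W'' (f : {linear V -> V'}) (f' : {linear V' -> V''})
    (g : {linear W -> W'}) (g' : {linear W' -> W''}) x :
  tmap f' g' (tmap f g x) = tmap (f' \o f) (g' \o g) x.
Proof.
by apply: (tens_ext (f := tmap f' g' \o tmap f g)) => v w /=; rewrite !tmapE.
Qed.

Lemma tassocK U V W : cancel (@tassoc U V W) (@tassocV U V W).
Proof.
move=> x; apply: (tens_ext3 (f := @tassocV U V W \o @tassoc U V W) (g := idl _)).
by move=> u v w /=; rewrite tassocE tassocVE.
Qed.

Lemma tassocVK U V W : cancel (@tassocV U V W) (@tassoc U V W).
Proof.
move=> x; apply: (tens_ext3V (f := @tassoc U V W \o @tassocV U V W) (g := idl _)).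
by move=> u v w /=; rewrite tassocVE tassocE.
Qed.

Lemma tassoc_nat U U' V V' W W' (f : {linear U -> U'}) (g : {linear V -> V'})
    (h : {linear W -> W'}) x :
  tassoc (tmap (tmap f g) h x) = tmap f (tmap g h) (tassoc x).
Proof.
apply: (tens_ext3 (f := @tassoc _ _ _ \o tmap (tmap f g) h)
                  (g := tmap f (tmap g h) \o @tassoc _ _ _)) => u v w /=.
by rewrite !(tmapE, tassocE).
Qed.

Lemma tassocV_nat U U' V V' W W' (f : {linear U -> U'}) (g : {linear V -> V'})
    (h : {linear W -> W'}) x :
  tassocV (tmap f (tmap g h) x) = tmap (tmap f g) h (tassocV x).
Proof. by apply: (can_inj (@tassocK U' V' W')); rewrite tassoc_nat !tassocVK. Qed.

Lemma tassocV_pentagon U V W Z (x : U ⊗ (V ⊗ (W ⊗ Z))) :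
  tmap (@tassoc U V W) (idl Z) (tassocV (tassocV x)) =
  tassocV (tmap (idl U) (@tassocV V W Z) x).
Proof.
apply: (tens_ext (f := tmap (@tassoc U V W) (idl Z) \o (@tassocV _ _ _ \o @tassocV _ _ _))
  (g := @tassocV _ _ _ \o tmap (idl U) (@tassocV V W Z))) => u {}x.
refine (tens_ext3V
  (f := tmap (@tassoc U V W) (idl Z) \o
          (@tassocV _ _ _ \o (@tassocV _ _ _ \o @pure k _ _ u)))
  (g := @tassocV _ _ _ \o (tmap (idl U) (@tassocV V W Z) \o @pure k _ _ u)) _ x).
by move=> v w z /=; rewrite !(tassocVE, tmapE, tassocE).
Qed.

Lemma tassocV_pentagonV U V W Z (x : U ⊗ (V ⊗ (W ⊗ Z))) :
  tmap (@tassocV U V W) (idl Z) (tassocV (tmap (idl U) (@tassocV V W Z) x)) =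
  tassocV (tassocV x).
Proof.
rewrite -tassocV_pentagon tmap_comp -[RHS]tmap_id.
by apply: eq_tmap => // y; apply: tassocK.
Qed.

Lemma tmap_compl V V' V'' W (f : {linear V -> V'}) (f' : {linear V' -> V''}) x :
  tmap (f' \o f) (idl W) x = tmap f' (idl W) (tmap f (idl W) x).
Proof. by rewrite tmap_comp; apply: eq_tmap. Qed.

Lemma tmap_compr V V' V'' W (f : {linear V -> V'}) (f' : {linear V' -> V''}) x :
  tmap (idl W) (f' \o f) x = tmap (idl W) f' (tmap (idl W) f x).
Proof. by rewrite tmap_comp; apply: eq_tmap. Qed.

Lemma tmap_lr V V' W W' (f : {linear V -> V'}) (g : {linear W -> W'}) x :
  tmap f (idl W') (tmap (idl V) g x) = tmap (idl V') g (tmap f (idl W) x).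
Proof. by rewrite !tmap_comp; apply: eq_tmap. Qed.

Lemma tassocV_natl U U' V W (f : {linear U -> U'}) x :
  tassocV (tmap f (idl (V ⊗ W)) x) = tmap (tmap f (idl V)) (idl W) (tassocV x).
Proof.
by rewrite -tassocV_nat; congr (tassocV _); apply: eq_tmap => // y; rewrite tmap_id.
Qed.

Lemma tassocV_natr U V W W' (h : {linear W -> W'}) x :
  tassocV (tmap (idl U) (tmap (idl V) h) x) = tmap (idl (U ⊗ V)) h (tassocV x).
Proof. by rewrite tassocV_nat; apply: eq_tmap => // y; rewrite tmap_id. Qed.

Lemma tlidVK V : cancel (@tlidV V) (@tlid V).
Proof. by move=> v; rewrite [LHS]tlidE scale1r. Qed.

Lemma tlidK V : cancel (@tlid V) (@tlidV V).
Proof.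
move=> x; apply: (tens_ext (f := @tlidV V \o @tlid V) (g := idl _)) => a v /=.
by rewrite tlidE linearZ -linearZl_LR; congr pure; apply: mulr1.
Qed.

Lemma tlid_nat V W (f : {linear V -> W}) x : f (tlid x) = tlid (tmap (idl k^o) f x).
Proof.
apply: (tens_ext (f := f \o @tlid V) (g := @tlid W \o tmap (idl _) f)) => a v /=.
by rewrite tmapE !tlidE linearZ.
Qed.

Lemma tlid_assoc V W x :
  tmap (@tlid V) (idl W) x = tlid (tassoc x).
Proof.
apply: (tens_ext3 (f := tmap (@tlid V) (idl W)) (g := @tlid _ \o @tassoc _ _ _)).
by move=> a v w /=; rewrite tmapE tassocE !tlidE linearZl_LR.
Qed.

Lemma trid_assoc V W x :
  tmap (@trid V) (idl W) x = tmap (idl V) (@tlid W) (tassoc x).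
Proof.
apply: (tens_ext3 (f := tmap (@trid V) (idl W))
                  (g := tmap (idl V) (@tlid W) \o @tassoc _ _ _)).
by move=> v a w /=; rewrite !(tmapE, tassocE) tlidE tridE linearZl_LR linearZr_LR.
Qed.

End TensorMaps.

Arguments tassoc {k U V W}.
Arguments tassocV {k U V W}.
Arguments tlid {k V}.
Arguments tlidV {k V}.
Arguments trid {k V}.

Section Kernel.
Variables (k : fieldType) (V W : lmodType k) (f : {linear V -> W}).

Definition ker_pred : {pred V} := fun v => f v == 0.
Lemma ker_pred_closed : submod_closed ker_pred.
Proof.
split=> [|a u v]; first by rewrite unfold_in linear0.
by rewrite !unfold_in => /eqP hu /eqP hv; rewrite linearP hu hv scaler0 addr0.
Qed.
HB.instance Definition _ := GRing.isSubmodClosed.Build k V ker_pred ker_pred_closed.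

Record ker := Ker { ker_val : V; _ : ker_val \in ker_pred }.
HB.instance Definition _ := [isSub for ker_val].
HB.instance Definition _ := [Choice of ker by <:].
HB.instance Definition _ := [SubChoice_isSubLmodule of ker by <:].

Lemma ker_val_is_linear : linear ker_val.
Proof. by []. Qed.
HB.instance Definition _ := GRing.isLinear.Build k ker V *:%R ker_val ker_val_is_linear.
Definition ker_incl : {linear ker -> V} := ker_val.

Lemma ker_inclP z : f (ker_incl z) = 0.
Proof. by case: z => v /= /eqP. Qed.

Lemma ker_incl_inj : injective ker_incl.
Proof. exact: val_inj. Qed.

Section Factor.
Variables (U : lmodType k) (g : {linear U -> V}) (fg0 : forall u, f (g u) = 0).
Lemma ker_factor_subproof u : g u \in ker_pred.
Proof. by rewrite unfold_in fg0. Qed.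
Definition ker_factor_fun u := Ker (ker_factor_subproof u).
Lemma ker_factor_is_linear : linear ker_factor_fun.
Proof. by move=> a u v; apply: ker_incl_inj; rewrite linearP /= linearP. Qed.
HB.instance Definition _ := GRing.isLinear.Build k U ker *:%R ker_factor_fun
  ker_factor_is_linear.
Definition ker_factor : {linear U -> ker} := ker_factor_fun.
Lemma ker_factorE u : ker_incl (ker_factor u) = g u.
Proof. by []. Qed.
End Factor.
End Kernel.

Section Coalgebras.
Variable k : fieldType.

Record is_coalgebra (C : lmodType k) (D : {linear C -> C ⊗ C})
    (e : {linear C -> k^o}) : Prop := IsCoalgebra {
  coassoc : forall c, tassoc (tmap D (idl C) (D c)) = tmap (idl C) D (D c);
  counitl : forall c, tlid (tmap e (idl C) (D c)) = c;
  counitr : forall c, trid (tmap (idl C) e (D c)) = c }.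

Record coalgebra := Coalgebra {
  coalg_sort :> lmodType k;
  comul : {linear coalg_sort -> coalg_sort ⊗ coalg_sort};
  counit : {linear coalg_sort -> k^o};
  coalgP : is_coalgebra comul counit }.

Definition coalgebra_iso (C D : coalgebra) : Prop :=
  exists f : {linear C -> D},
    [/\ bijective f,
        forall c, comul D (f c) = tmap f f (comul C c) &
        forall c, counit D (f c) = counit C c].

End Coalgebras.

Section Comodules.
Variables (k : fieldType) (C : coalgebra k).

Record rcomodule := RComodule {
  rcomod_sort :> lmodType k;
  rcoact : {linear rcomod_sort -> rcomod_sort ⊗ C};
  rcoactA : forall m, tassoc (tmap rcoact (idl C) (rcoact m)) =
                      tmap (idl rcomod_sort) (comul C) (rcoact m);
  rcoact1 : forall m, trid (tmap (idl rcomod_sort) (counit C) (rcoact m)) = m }.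

Record lcomodule := LComodule {
  lcomod_sort :> lmodType k;
  lcoact : {linear lcomod_sort -> C ⊗ lcomod_sort};
  lcoactA : forall n, tassoc (tmap (comul C) (idl lcomod_sort) (lcoact n)) =
                      tmap (idl C) lcoact (lcoact n);
  lcoact1 : forall n, tlid (tmap (counit C) (idl lcomod_sort) (lcoact n)) = n }.

Record comod_hom (M N : rcomodule) := ComodHom {
  comod_fun :> {linear M -> N};
  comod_funP : forall m, rcoact N (comod_fun m) = tmap comod_fun (idl C) (rcoact M m) }.

Lemma comod_hom_ext (M N : rcomodule) (f g : comod_hom M N) : f =1 g -> f = g.
Proof.
case: f g => [f fP] [g gP] /= /funext fg.
have {}fg : f = g.
  case: f g fP gP fg => [f [[f1] [f2]]] [g [[g1] [g2]]] _ _ /= fg.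
  by case: g / fg g1 g2 => g1 g2; rewrite (Prop_irrelevance f1 g1) (Prop_irrelevance f2 g2).
by subst g; rewrite (Prop_irrelevance fP gP).
Qed.

Definition comod_id (M : rcomodule) : comod_hom M M.
Proof. by exists (idl M) => m; rewrite tmap_id. Defined.

Definition comod_comp (M N P : rcomodule) (g : comod_hom N P) (f : comod_hom M N) :
  comod_hom M P.
Proof. by exists (g \o f) => m; rewrite /= !comod_funP tmap_comp. Defined.

(* A monomorphism of comodules over a field is the same as an injective one. *)
Definition injective_comodule (L : rcomodule) : Prop :=
  forall (M N : rcomodule) (i : comod_hom M N), injective i ->
  forall f : comod_hom M L, exists g : comod_hom N L, forall m, g (i m) = f m.

Definition regular_comodule : rcomodule :=
  RComodule (coassoc (coalgP C)) (counitr (coalgP C)).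


Section TensorComodule.
Variables (V : lmodType k) (M : rcomodule).
Definition tcoact : {linear V ⊗ M -> (V ⊗ M) ⊗ C} :=
  tassocV \o tmap (idl V) (rcoact M).

Lemma tcoactA x : tassoc (tmap tcoact (idl C) (tcoact x)) =
                  tmap (idl (V ⊗ M)) (comul C) (tcoact x).
Proof.
apply: (can_inj (@tassocVK k _ _ _)); rewrite tassocK /tcoact tmap_compl /= -tassocV_nat.
rewrite -tassocV_natr -tassocV_pentagonV; congr (tmap _ _ (tassocV _)).
rewrite !tmap_comp; apply: eq_tmap => // m /=.
by rewrite -rcoactA tassocK.
Qed.

Lemma tcoact1 x : trid (tmap (idl (V ⊗ M)) (counit C) (tcoact x)) = x.
Proof.
rewrite -tassocV_natr.
have -> y : trid (tassocV y) = tmap (idl V) (@trid _ M) y.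
  apply: (tens_ext3V (f := trid \o tassocV) (g := tmap (idl V) trid)) => v m a /=.
  by rewrite tassocVE tmapE !tridE linearZr_LR.
rewrite !tmap_comp -[RHS]tmap_id; apply: eq_tmap => // m; exact: rcoact1.
Qed.

Definition tcomodule : rcomodule := RComodule tcoactA tcoact1.
End TensorComodule.

Definition tcomod_mapl (V W : lmodType k) (g : {linear V -> W}) M :
  comod_hom (tcomodule V M) (tcomodule W M).
Proof.
by exists (tmap g (idl M)) => x; rewrite /= /tcoact /= -tmap_lr tassocV_natl.
Defined.

Definition tcomod_mapr (V : lmodType k) M N (f : comod_hom M N) :
  comod_hom (tcomodule V M) (tcomodule V N).
Proof.
exists (tmap (idl V) f) => x; rewrite /= /tcoact /= -tassocV_nat !tmap_comp.
by congr (tassocV _); apply: eq_tmap => // m /=; rewrite comod_funP.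
Defined.

Definition tcomod_assoc (V W : lmodType k) M :
  comod_hom (tcomodule V (tcomodule W M)) (tcomodule (V ⊗ W) M).
Proof.
exists tassocV => x; rewrite /= /tcoact /= -tassocV_natr tmap_compr.
by rewrite tassocV_pentagonV.
Defined.

Definition tcomod_unit M : comod_hom M (tcomodule k^o M).
Proof.
exists tlidV => m; rewrite /= /tcoact /=.
rewrite [tlidV m]/(@tlidV_fun _ _ m) /tlidV_fun tmapE /=.
rewrite [rcoact M m]tens_sum_pure !linear_sum; apply: eq_bigr => p _.
by rewrite tassocVE tmapE.
Defined.

Definition rcoact_hom M : comod_hom M (tcomodule M regular_comodule).
Proof. by exists (rcoact M) => m; rewrite /= /tcoact /= -rcoactA tassocK. Defined.

Record functor := Functor {
  fobj :> rcomodule -> lmodType k;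
  fmap : forall M N, comod_hom M N -> {linear fobj M -> fobj N};
  fmap_id : forall M x, fmap (comod_id M) x = x;
  fmap_comp : forall M N P (g : comod_hom N P) (f : comod_hom M N) x,
    fmap (comod_comp g f) x = fmap g (fmap f x) }.

(* F is left adjoint to the functor V |-> V ⊗ L from vector spaces to right
   C-comodules, presented by its unit and counit. *)
Record adjunction (F : functor) (L : rcomodule) := Adjunction {
  adj_unit : forall M, comod_hom M (tcomodule (F M) L);
  adj_counit : forall V, {linear F (tcomodule V L) -> V};
  adj_unit_nat : forall M N (f : comod_hom M N) m,
    adj_unit N (f m) = tcomod_mapl (fmap F f) L (adj_unit M m);
  adj_counit_nat : forall (V W : lmodType k) (g : {linear V -> W}) x,
    adj_counit W (fmap F (tcomod_mapl g L) x) = g (adj_counit V x);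
  adj_triangle1 : forall M x,
    adj_counit (F M) (fmap F (adj_unit M) x) = x;
  adj_triangle2 : forall V y,
    tcomod_mapl (adj_counit V) L (adj_unit (tcomodule V L) y) = y }.

(* An element of [quasi_finite L] is a choice of the functor h_C(L,-), which
   quasi-finiteness determines only up to a unique isomorphism. *)
Record quasi_finite (L : rcomodule) := QuasiFinite {
  cohom : functor;
  cohom_adj : adjunction cohom L }.

Section Cohom.
Variables (L : rcomodule) (qf : quasi_finite L).
Local Notation h := (cohom qf).

Definition theta M : comod_hom M (tcomodule (h M) L) := adj_unit (cohom_adj qf) M.

(* The linear map h M -> V that corresponds to f under the adjunction; it is the
   only one with the property [transposeP], by [cohom_ext]. *)
Definition transpose M (V : lmodType k) (f : comod_hom M (tcomodule V L)) : {linear h M -> V} :=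
  adj_counit (cohom_adj qf) V \o fmap h f.

Lemma transposeP M (V : lmodType k) (f : comod_hom M (tcomodule V L)) m :
  tmap (transpose f) (idl L) (theta M m) = f m.
Proof.
rewrite /transpose tmap_compl.
have /= <- := adj_unit_nat (cohom_adj qf) f m.
exact: (adj_triangle2 (cohom_adj qf)).
Qed.

Lemma cohom_ext M (V : lmodType k) (f g : {linear h M -> V}) :
  (forall m, tmap f (idl L) (theta M m) = tmap g (idl L) (theta M m)) -> f =1 g.
Proof.
move=> fg x.
have e (u : {linear h M -> V}) :
    u x = adj_counit (cohom_adj qf) V (fmap h (comod_comp (tcomod_mapl u L) (theta M)) x).
  by rewrite fmap_comp adj_counit_nat adj_triangle1.
rewrite e [RHS]e; congr (adj_counit _ _ (fmap h _ x)).
exact: comod_hom_ext.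
Qed.
Lemma theta_nat M N (f : comod_hom M N) m :
  theta N (f m) = tmap (fmap h f) (idl L) (theta M m).
Proof. exact: adj_unit_nat. Qed.

(* The canonical map h(V ⊗ M) -> V ⊗ h(M), characterized by
   (cohom_tens ⊗ L) theta = V ⊗ theta_M.  It is the isomorphism by which the left
   adjoint h commutes with V ⊗ -. *)
Definition cohom_tens (V : lmodType k) M :
    {linear h (tcomodule V M) -> V ⊗ h M} :=
  transpose (comod_comp (tcomod_assoc V (h M) L) (tcomod_mapr V (theta M))).

(* rcoact_hom regular_comodule is the comultiplication of C, seen as a comodule
   map from C to C ⊗ C with coaction on the right factor. *)
Definition cohomC_coact : {linear h regular_comodule -> C ⊗ h regular_comodule} :=
  cohom_tens C regular_comodule \o fmap h (rcoact_hom regular_comodule).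

Local Notation thetaC := (theta regular_comodule).

Lemma cohomC_coactP c : tmap cohomC_coact (idl L) (thetaC c) =
  tassocV (tmap (idl C) thetaC (comul C c)).
Proof.
by rewrite /cohomC_coact tmap_compl -theta_nat transposeP.
Qed.

Lemma cohomC_coactA x :
  tassoc (tmap (comul C) (idl _) (cohomC_coact x)) =
  tmap (idl C) cohomC_coact (cohomC_coact x).
Proof.
apply: (cohom_ext (f := tassoc \o (tmap (comul C) (idl _) \o cohomC_coact))
                  (g := tmap (idl C) cohomC_coact \o cohomC_coact)) => c.
rewrite 2![in LHS]tmap_compl [in RHS]tmap_compl !cohomC_coactP -tassocV_natl tmap_lr.
rewrite -tassocV_nat.
have -> : tmap (comul C) (idl C) (comul C c) =
          tassocV (tmap (idl C) (comul C) (comul C c)).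
  by rewrite -(coassoc (coalgP C)) tassocK.
rewrite -tassocV_natr tassocV_pentagon; congr (tassocV _).
by rewrite !tmap_comp; apply: eq_tmap => // c' /=; rewrite cohomC_coactP.
Qed.

Lemma cohomC_coact1 x : tlid (tmap (counit C) (idl _) (cohomC_coact x)) = x.
Proof.
apply: (cohom_ext (f := tlid \o (tmap (counit C) (idl _) \o cohomC_coact))
                  (g := idl _)) => c.
rewrite 2![in LHS]tmap_compl  !cohomC_coactP -tassocV_natl tmap_lr tlid_assoc tassocVK.
by rewrite -tlid_nat (counitl (coalgP C)) tmap_id.
Qed.

(* The left comodule X = h_C(L,C). *)
Definition cohomC : lcomodule := LComodule cohomC_coactA cohomC_coact1.

(* [ecomul] and [ecounit] are the unique linear maps satisfying [ecomulP] and
   [ecounitP], by [cohom_ext]. *)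
Definition ecomul : {linear h L -> h L ⊗ h L} :=
  transpose (comod_comp (tcomod_assoc (h L) (h L) L)
    (comod_comp (tcomod_mapr (h L) (theta L)) (theta L))).

Definition ecounit : {linear h L -> k^o} := transpose (tcomod_unit L).

Lemma ecomulP l : tmap ecomul (idl L) (theta L l) =
  tassocV (tmap (idl (h L)) (theta L) (theta L l)).
Proof. exact: transposeP. Qed.

Lemma ecounitP l : tmap ecounit (idl L) (theta L l) = tlidV l.
Proof. exact: transposeP. Qed.

Lemma e_is_coalgebra : is_coalgebra ecomul ecounit.
Proof.
split=> x.
- apply: (cohom_ext (f := tassoc \o (tmap ecomul (idl _) \o ecomul))
                    (g := tmap (idl _) ecomul \o ecomul)) => l.
  rewrite 2![in LHS]tmap_compl [in RHS]tmap_compl !ecomulP -tassocV_natl tmap_lr -tassocV_nat ecomulP.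
  rewrite -tassocV_natr tassocV_pentagon; congr (tassocV _).
  by rewrite !tmap_comp; apply: eq_tmap => // c' /=; rewrite ecomulP.
- apply: (cohom_ext (f := tlid \o (tmap ecounit (idl _) \o ecomul))
                    (g := idl _)) => l.
  rewrite 2![in LHS]tmap_compl  !ecomulP -tassocV_natl tmap_lr tlid_assoc tassocVK.
  by rewrite ecounitP -tlid_nat tlidVK tmap_id.
- apply: (cohom_ext (f := trid \o (tmap (idl _) ecounit \o ecomul))
                    (g := idl _)) => l.
  rewrite 2![in LHS]tmap_compl  !ecomulP -tassocV_nat trid_assoc tassocVK !tmap_comp.
  by apply: eq_tmap => // l' /=; rewrite ecounitP tlidVK.
Qed.

Definition e_coalgebra : coalgebra k := Coalgebra e_is_coalgebra.

End Cohom.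

Section Cotensor.
Variable N : lcomodule.
Implicit Types M : rcomodule.

Definition cotensor_map M : {linear M ⊗ N -> M ⊗ (C ⊗ N)} :=
  (tassoc \o tmap (rcoact M) (idl N)) \- tmap (idl M) (lcoact N).

Definition cotensor M : lmodType k := ker (cotensor_map M).
Definition cotensor_incl M : {linear cotensor M -> M ⊗ N} := ker_incl (cotensor_map M).

Lemma cotensorP M z : tassoc (tmap (rcoact M) (idl N) (cotensor_incl M z)) =
  tmap (idl M) (lcoact N) (cotensor_incl M z).
Proof. by apply/eqP; rewrite -subr_eq0; apply/eqP/(ker_inclP (f := cotensor_map M)). Qed.

Lemma cotensor_fmap_subproof M M' (f : comod_hom M M') z :
  cotensor_map M' ((tmap f (idl N) \o cotensor_incl M) z) = 0.
Proof.
apply/eqP; rewrite subr_eq0 /=; apply/eqP.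
have -> : tmap (rcoact M') (idl N) (tmap f (idl N) (cotensor_incl M z)) =
   tmap (tmap f (idl C)) (idl N) (tmap (rcoact M) (idl N) (cotensor_incl M z)).
  by rewrite !tmap_comp; apply: eq_tmap => // m; apply: comod_funP.
rewrite tassoc_nat cotensorP !tmap_comp; apply: eq_tmap => // n /=.
by rewrite tmap_id.
Qed.

Definition cotensor_fmap M M' (f : comod_hom M M') :
    {linear cotensor M -> cotensor M'} :=
  ker_factor (cotensor_fmap_subproof f).

Definition cotensor_functor : functor.
Proof.
exists cotensor cotensor_fmap => [M x|M P Q g f x]; apply: ker_incl_inj => /=.
  exact: tmap_id.
exact: tmap_compl.
Defined.

Lemma tens_cotensor_subproof (V : lmodType k) M t :
  cotensor_map (tcomodule V M)
    ((tassocV \o tmap (idl V) (cotensor_incl M)) t) = 0.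
Proof.
apply/eqP; rewrite subr_eq0 /= /tcoact; apply/eqP.
apply: (can_inj (@tassocVK k _ _ _)).
rewrite tassocK -tassocV_natr tmap_compl /= -tassocV_nat -tassocV_pentagonV.
congr (tmap _ _ (tassocV _)); rewrite !tmap_comp; apply: eq_tmap => // z /=.
by rewrite -cotensorP tassocK.
Qed.

(* The canonical isomorphism V ⊗ (M □ N) -> (V ⊗ M) □ N. *)
Definition tens_cotensor (V : lmodType k) M :
    {linear V ⊗ cotensor M -> cotensor (tcomodule V M)} :=
  ker_factor (@tens_cotensor_subproof V M).

End Cotensor.

Section CotensorCoalgebra.
Variables (L : rcomodule) (qf : quasi_finite L).
Local Notation X := (cohomC qf).
Local Notation thetaC := (theta qf regular_comodule).
Local Notation incl := (cotensor_incl X).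

(* The coalgebra L □ X.

   Its comultiplication is the composite
     L □ X ≃ L □ C □ X -> L □ (X ⊗ L) □ X ≃ (L □ X) ⊗ (L □ X)
   whose first arrow is given by the coaction of L and whose second arrow is
   L □ theta_C □ X.  [ccomulP] states this inside (L ⊗ X) ⊗ (L ⊗ X).

   Its counit is the map ω such that V ⊗ ω is the counit at V of the adjunction
   between - □ X and - ⊗ L with unit M ≃ M □ C -> (M □ X) ⊗ L, the second arrow
   being M □ theta_C.  [cadj_unit] states the latter inside M ⊗ (X ⊗ L).

   Over a field, tensor products preserve injective maps, so that [ccomulP] has
   at most one solution [ccomul] and [cadj_unit] fixes the unit of [cadj], hence
   its counit; the counit at V = k then gives back ω.  The two maps are therefore
   determined by the conditions stated. *)
Record cotensor_coalgebra := CotensorCoalgebra {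
  ccomul : {linear cotensor X L -> cotensor X L ⊗ cotensor X L};
  ccounit : {linear cotensor X L -> k^o};
  ccoalgP : is_coalgebra ccomul ccounit;
  ccomulP : forall z, tmap (incl L) (incl L) (ccomul z) =
    tassoc (tmap (@tassocV _ L X L) (idl X)
      (tmap (tmap (idl L) thetaC) (idl X) (tmap (rcoact L) (idl X) (incl L z))));
  cadj : adjunction (cotensor_functor X) L;
  cadj_unit : forall M m, tassoc (tmap (incl M) (idl L) (adj_unit cadj M m)) =
    tmap (idl M) thetaC (rcoact M m);
  cadj_counit : forall V t,
    adj_counit cadj V (tens_cotensor X V L t) = trid (tmap (idl V) ccounit t) }.

Coercion coalgebra_of_cotensor (D : cotensor_coalgebra) : coalgebra k :=
  Coalgebra (ccoalgP D).

End CotensorCoalgebra.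

End Comodules.

(* Main.v *)
Require Import Defs.
From HB Require Import structures.
From mathcomp Require Import all_boot all_order all_algebra.
From mathcomp Require Import sesquilinear boolp classical_sets.

(* Write h for the cohom functor h_C(L,-) and X = h(C).  Since Hom(h(M), k) is
   the space of comodule maps from M to L, injectivity of L makes h preserve
   injections; being a left adjoint, h is then exact.  It also commutes with
   V ⊗ -.  Applied to the exact sequence 0 -> M -> M ⊗ C -> M ⊗ C ⊗ C, it
   therefore yields an exact sequence 0 -> h(M) -> M ⊗ X -> M ⊗ C ⊗ X, that is,
   a natural isomorphism h(M) ≃ M □ X.  The adjunction and, for M = L, the
   coalgebra structure of e_C(L) are transported along it; the transported
   comultiplication is the expected one because theta_C is colinear. *)

Set Implicit Arguments.
Unset Strict Implicit.
Unset Printing Implicit Defensive.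

Import GRing.Theory.
Local Open Scope ring_scope.

(** * Linear retractions and functionals, by Zorn's lemma *)

Section Retraction.
Local Open Scope classical_set_scope.
Variables (k : fieldType) (V W : lmodType k).

(** Such a set, when nonempty, is the graph of a linear map from a subspace of W to V; a pair (w, v)
    says that w is sent to v. The second clause makes the relation single-valued. The empty set is
    allowed. *)
Definition functional_subspace (G : set (W * V)) : Prop :=
  (forall a p q, G p -> G q -> G (a *: p + q)) /\ (forall v, G (0, v) -> v = 0).

(** Zorn's lemma gives a maximal partial linear map extending J. Its domain is all of W, since a
    vector w outside it could be sent to 0. *)
Lemma maximal_functional_subspace (J : set (W * V)) :
  J 0 -> functional_subspace J ->
  exists G, [/\ J `<=` G, functional_subspace G & forall w, exists v, G (w, v)].
Proof.
(* Zorn's lemma is applied to all chains, the empty one included. Adding J inside [P] makes the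
   empty union satisfy [P] and forces the maximal graph to contain J. *)
move=> J0 Jf; pose P A := functional_subspace (A `|` J).
have [|A [[Al Af] Amax]] := @Zorn_bigcup _ P.
  move=> F FP Ftot; set U := \bigcup_(_ in F) _.
  have P0 : P set0 by rewrite /P set0U.
  (* A point of J is attributed to the empty set, which is comparable with every member of the
     chain. *)
  have pick p : (U `|` J) p -> exists X, [/\ F X \/ X = set0 & (X `|` J) p].
    by case=> [[X FX Xp]|Jp]; [exists X; split; left | exists set0; split; right].
  have FXP X : F X \/ X = set0 -> P X by case=> [/FP //|->].
  have FXU X : F X \/ X = set0 -> X `|` J `<=` U `|` J.
    case=> [FX p [Xp|Jp]|-> p [//|Jp]]; [by left; exists X| by right..].
  split=> [a p q /pick[X [FX Xp]] /pick[Y [FY Yq]]|v /pick[X [FX Xv]]].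
    have [XY|YX] : X `<=` Y \/ Y `<=` X.
    - case: FX => [FX|->]; last by left.
      by case: FY => [FY|->]; [apply: Ftot|right].
    - by apply: (FXU _ FY); apply: (FXP _ FY).1 => //; case: Xp => [/XY|]; [left|right].
    - by apply: (FXU _ FX); apply: (FXP _ FX).1 => //; case: Yq => [/YX|]; [left|right].
  exact: (FXP _ FX).2 Xv.
exists (A `|` J); split=> // w; apply: contrapT => Aw.
(* The extension that sends w to 0. *)
pose B := [set p : W * V | exists a q, (A `|` J) q /\ p = (q.1 + a *: w, q.2)].
have AB : A `|` J `<=` B.
  by move=> [x y] Axy; exists 0, (x, y); split=> //=; rewrite scale0r addr0.
apply: (Amax B).
  split=> [p Ap|BA]; first by apply: AB; left.
  apply: Aw; exists 0; left; apply: BA; exists 1, 0; split; first by right.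
  by rewrite /= scale1r add0r.
rewrite /P; have -> : B `|` J = B by apply/setUidPl => p Jp; apply: AB; right.
split=> [a _ _ [b [p [Ap ->]]] [c [q [Aq ->]]]|v [a [[x y] [Axy [e ->]]]]].
  exists (a * b + c), (a *: p + q); split; first exact: Al.
  by congr pair => /=; rewrite scalerDr scalerA addrACA -scalerDl.
(* Here 0 = x + a w with x in the old domain: a nonzero a would put w in that domain as well. *)
have [a0|a0] := eqVneq a 0.
  by apply: Af; move: Axy; rewrite e a0 scale0r addr0.
case: Aw; exists (- a^-1 *: y).
have -> : w = - a^-1 *: x.
  have /eqP -> : x == - (a *: w) by rewrite -addr_eq0 -e.
  by rewrite scaleNr scalerN opprK scalerA mulVf // scale1r.
rewrite -[(_, _)]addr0; apply: (Al (- a^-1) (x, y) 0) => //; by right.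
Qed.

(** The inverse of j on its image, given by the pairs (j v, v), extends to a linear map on W. *)
Lemma injective_retraction (j : {linear V -> W}) :
  injective j -> exists r : {linear W -> V}, forall v, r (j v) = v.
Proof.
move=> jI; have [||G [JG [Gl Gf] Gt]] :=
  @maximal_functional_subspace [set p | p.1 = j p.2].
- by rewrite /= linear0.
- split=> [a p q /= -> ->|v /= e]; first by rewrite linearP.
  by apply: jI; rewrite -e linear0.
have [r rP] := choice Gt.
have rE w v : G (w, v) -> r w = v.
  move=> Gv; apply/eqP; rewrite -subr_eq0 -scaleN1r addrC; apply/eqP/Gf.
  have -> : (0, -1 *: v + r w) = -1 *: (w, v) + (w, r w).
    by congr pair => /=; rewrite scaleN1r addNr.
  exact: Gl Gv (rP w).
have rl : linear r by move=> a u v; apply: rE; apply: (Gl a (u, r u) (v, r v)).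
pose R : {linear W -> V} := HB.pack r (GRing.isLinear.Build k W V *:%R r rl).
by exists R => v; apply: rE; apply: JG.
Qed.
End Retraction.

(** For nonzero v the map a ↦ a v from k is injective, and a retraction of it is a functional with
    value 1 at v. *)
Lemma separating_functional (k : fieldType) (V : lmodType k) (v : V) :
  (forall f : {linear V -> k^o}, f v = 0) -> v = 0.
Proof.
move=> fv; apply: contrapT => v0; pose j (a : k^o) : V := (a : k) *: v.
have jl : linear j by move=> a b c; rewrite /j scalerDl -scalerA.
pose J : {linear k^o -> V} := HB.pack j (GRing.isLinear.Build k k^o V *:%R j jl).
have [a b /eqP|r rP] := @injective_retraction k _ _ J.
  rewrite /= /j -subr_eq0 -scalerBl scaler_eq0 subr_eq0.
  by case/orP=> /eqP.
have := rP 1; rewrite /= /j scale1r fv => /eqP.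
by rewrite eq_sym oner_eq0.
Qed.

(** * Further identities for tensor products of linear maps *)

Section TensorMapsLinear.
Variables (k : fieldType) (V V' W : lmodType k).

Lemma tmap_subl (f g : {linear V -> V'}) x :
  tmap (f \- g) (idl W) x = tmap f (idl W) x - tmap g (idl W) x.
Proof.
apply: (tens_ext (f := tmap (f \- g) (idl W)) (g := tmap f (idl W) \- tmap g (idl W))) => v w /=.
by rewrite !tmapE -linearBl.
Qed.

Lemma tmap0l x : tmap (\0 : {linear V -> V'}) (idl W) x = 0.
Proof.
apply: (tens_ext (f := tmap (\0 : {linear V -> V'}) (idl W)) (g := \0)) => v w.
by rewrite tmapE /= linear0l.
Qed.

Lemma tmap_pure_idr (x : V ⊗ W) (u : V') :
  tmap (pure u) (idl W) x = tassocV (pure u x).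
Proof.
apply: (tens_ext (f := tmap (pure u : {linear V -> _}) (idl W))
  (g := tassocV \o (pure u : {linear _ -> _}))) => v w /=.
by rewrite tmapE tassocVE.
Qed.

Lemma trid_nat (f : {linear V -> W}) x : trid (tmap f (idl k^o) x) = f (trid x).
Proof.
apply: (tens_ext (f := trid \o tmap f (idl k^o)) (g := f \o trid)) => v a /=.
by rewrite tmapE !tridE linearZ.
Qed.
End TensorMapsLinear.

(** * The cokernel of a comodule map with a linear retraction *)

Section Cokernel.
Variables (k : fieldType) (C : coalgebra k).
Implicit Types M N P : rcomodule C.

Definition comod_sub M N (f g : comod_hom M N) : comod_hom M N.
Proof. by exists (f \- g) => m; rewrite tmap_subl linearB /= !comod_funP. Defined.

Definition tcomod_pure (V : lmodType k) (v : V) M : comod_hom M (tcomodule V M).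
Proof. by exists (pure v : {linear M -> V ⊗ M}) => m; rewrite /= /tcoact /= tmapE tmap_pure_idr. Defined.

Variables (M N : rcomodule C) (f : comod_hom M N) (s : {linear N -> M}).
Hypothesis sf : forall m, s (f m) = m.

(** The cokernel is modelled on the complement [ker s] of the image of f, with projection n ↦ n - f
    (s n), so that no quotient is formed. As s is only linear, the complement need not be a
    subcomodule; its coaction is that of N followed by the projection. *)
Definition split_coker : lmodType k := ker s.
Local Notation incl := (ker_incl s).

Lemma split_proj_subproof n : s ((idl N \- (f \o s)) n) = 0.
Proof. by rewrite /= linearB /= sf subrr. Qed.
Definition split_proj : {linear N -> split_coker} := ker_factor split_proj_subproof.

Lemma split_incl_proj n : incl (split_proj n) = n - f (s n). Proof. by []. Qed.
Lemma split_proj_incl q : split_proj (incl q) = q.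
Proof.
by apply: ker_incl_inj; rewrite split_incl_proj (ker_inclP (f := s)) linear0 subr0.
Qed.
Lemma split_proj_hom m : split_proj (f m) = 0.
Proof. by apply: ker_incl_inj; rewrite split_incl_proj sf subrr. Qed.

Definition split_coact : {linear split_coker -> split_coker ⊗ C} :=
  tmap split_proj (idl C) \o (rcoact N \o incl).

(** Since f is colinear, the coaction sends f (s n) into the image of f ⊗ C, which the projection
    kills. *)
Lemma split_coact_proj n :
  split_coact (split_proj n) = tmap split_proj (idl C) (rcoact N n).
Proof.
rewrite -[LHS]/(tmap split_proj (idl C) (rcoact N (incl (split_proj n)))) split_incl_proj.
rewrite 2!linearB /= comod_funP tmap_comp.
rewrite [X in _ - X](_ : _ = 0) ?subr0 // -[RHS](@tmap0l _ M split_coker C (rcoact M (s n))).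
by apply: eq_tmap => // m /=; rewrite split_proj_hom.
Qed.

Lemma split_coactA q : tassoc (tmap split_coact (idl C) (split_coact q)) =
  tmap (idl split_coker) (comul C) (split_coact q).
Proof.
rewrite -(split_proj_incl q) split_coact_proj.
have /(congr1 (tmap split_proj (idl (C ⊗ C)))) := rcoactA (ker_incl s q).
rewrite tmap_lr => <-.
have E x : tmap split_proj (idl (C ⊗ C)) (tassoc x) =
           tassoc (tmap (tmap split_proj (idl C)) (idl C) x).
  by rewrite tassoc_nat; apply: eq_tmap => // y; rewrite tmap_id.
rewrite E; congr (tassoc _); rewrite !tmap_comp; apply: eq_tmap => // n /=.
exact: split_coact_proj.
Qed.

Lemma split_coact1 q :
  trid (tmap (idl split_coker) (counit C) (split_coact q)) = q.
Proof.
rewrite /split_coact /= -tmap_lr.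
by rewrite trid_nat rcoact1 split_proj_incl.
Qed.

Definition split_cokernel : rcomodule C := RComodule split_coactA split_coact1.

Definition split_cokernel_proj : comod_hom N split_cokernel.
Proof. by exists split_proj => n; apply: split_coact_proj. Defined.

(** The inclusion of the complement is only linear, but its composite with g is colinear: g kills f,
    hence does not change when n is replaced by n - f (s n). *)
Definition split_cokernel_factor P (g : comod_hom N P) (gf : forall m, g (f m) = 0) :
  comod_hom split_cokernel P.
Proof.
exists (g \o incl : {linear split_coker -> P}) => q.
rewrite /= comod_funP /split_coact /= tmap_comp; apply: eq_tmap => // n /=.
by rewrite -[RHS]/(g (incl (split_proj n))) split_incl_proj linearB /= gf subr0.
Defined.

Lemma split_cokernel_factorE P (g : comod_hom N P) (gf : forall m, g (f m) = 0) n :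
  split_cokernel_factor gf (split_cokernel_proj n) = g n.
Proof.
by rewrite -[LHS]/(g (incl (split_proj n))) split_incl_proj linearB /= gf subr0.
Qed.
End Cokernel.

(** * Additivity and exactness of the cohom functor *)

Section CohomExact.
Variables (k : fieldType) (C : coalgebra k) (L : rcomodule C) (qf : quasi_finite L).
Implicit Types M N P : rcomodule C.
Local Notation h := (cohom qf).

(** Additivity is not built into [functor]; it follows from naturality of theta, since linear maps
    out of h(M) are determined by their effect on theta. *)
Lemma cohom_sub M N (f g : comod_hom M N) x :
  fmap h (comod_sub f g) x = fmap h f x - fmap h g x.
Proof.
apply: (cohom_ext (f := fmap h (comod_sub f g)) (g := fmap h f \- fmap h g)) => m.
by rewrite tmap_subl -!theta_nat /= linearB.
Qed.

Definition comod_lid M : comod_hom (tcomodule k^o M) M.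
Proof.
exists tlid => x.
by rewrite tlid_nat /= /tcoact /= tlid_assoc tassocVK.
Defined.

Hypothesis injL : injective_comodule L.

(** A functional phi on h(M) corresponds to a comodule map from M to k ⊗ L ≃ L. Injectivity of L
    extends it along i, and the transpose of the extension, composed with h(i), is phi. So every
    functional vanishes on the kernel of h(i). *)
Lemma cohom_injective M N (i : comod_hom M N) : injective i -> injective (fmap h i).
Proof.
move=> iI; apply: raddf_inj => y hy; apply: separating_functional => phi.
have [g gi] := injL iI (comod_comp (comod_lid L) (comod_comp (tcomod_mapl phi L) (theta qf M))).
have E : transpose qf (comod_comp (tcomod_unit L) g) \o fmap h i =1 phi.
  apply: cohom_ext => m; rewrite tmap_compl -theta_nat transposeP /=.
  by rewrite gi /= tlidK.
by rewrite -E /= hy !linear0.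
Qed.

(* h is exact at N: the kernel of h(d) lies in that of h(N) -> h(coker f), because
   coker f embeds in P; and if p has kernel im h(f), then the map N -> h(N) ⊗ L
   adjoint to p factors through coker f. *)
Lemma cohom_exact M N P (f : comod_hom M N) (s : {linear N -> M}) (d : comod_hom N P) :
    (forall m, s (f m) = m) -> (forall m, d (f m) = 0) ->
    (forall n, d n = 0 -> f (s n) = n) ->
  forall t, fmap h d t = 0 -> exists y, fmap h f y = t.
Proof.
move=> sf df dker t dt.
have [r rP] := injective_retraction (cohom_injective (can_inj sf)).
pose i := split_cokernel_factor sf df; pose pi := split_cokernel_proj sf.
have iI : injective i.
  apply: raddf_inj => q /dker iq; apply: ker_incl_inj; rewrite -iq.
  by rewrite (ker_inclP (f := s)) !linear0.
have pit : fmap h pi t = 0.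
  apply: (cohom_injective iI); rewrite -fmap_comp linear0 -[RHS]dt.
  by congr (fmap h _ t); apply: comod_hom_ext => n; apply: split_cokernel_factorE.
(* As r retracts h(f), the map p kills the image of h(f), and p t = 0 exhibits r t as a preimage of
   t. *)
pose p : {linear h N -> h N} := idl _ \- (fmap h f \o r).
have gf m : comod_comp (tcomod_mapl p L) (theta qf N) (f m) = 0.
  rewrite /= theta_nat -tmap_compl -[RHS](@tmap0l _ (h M) (h N) L (theta qf M m)).
  by apply: eq_tmap => // x /=; rewrite rP subrr.
have E : transpose qf (split_cokernel_factor sf gf) \o fmap h pi =1 p.
  apply: cohom_ext => n; rewrite tmap_compl -theta_nat transposeP.
  exact: (split_cokernel_factorE sf gf n).
exists (r t); apply/eqP; rewrite eq_sym -subr_eq0; apply/eqP.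
by rewrite -[LHS]/(p t) -E /= pit !linear0.
Qed.

End CohomExact.

(** * Commutation of h with V ⊗ - *)

Lemma tmap_lincombl (k : fieldType) (V V' W : lmodType k) a (f g : {linear V -> V'}) x :
  tmap ((a \*: f) \+ g) (idl W) x = a *: tmap f (idl W) x + tmap g (idl W) x.
Proof.
apply: (tens_ext (f := tmap ((a \*: f) \+ g) (idl W))
  (g := (a \*: tmap f (idl W)) \+ tmap g (idl W))) => v w /=.
by rewrite !tmapE /= linearDl linearZl_LR.
Qed.

Section CohomTensor.
Variables (k : fieldType) (C : coalgebra k) (L : rcomodule C) (qf : quasi_finite L).
Implicit Types M N P : rcomodule C.
Local Notation h := (cohom qf).

Section Inverse.
Variables (V : lmodType k) (M : rcomodule C).

Lemma cohom_tensP y : tmap (cohom_tens qf V M) (idl L) (theta qf (tcomodule V M) y) =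
  tassocV (tmap (idl V) (theta qf M) y).
Proof. exact: transposeP. Qed.

(** The inverse of [cohom_tens] on elementary tensors: each v gives a comodule map m ↦ v ⊗ m, to
    which h is applied. *)
Definition cohom_tensV_fun (v : V) (x : h M) := fmap h (tcomod_pure v M) x.
Lemma cohom_tensV_bilinear : bilinear_for *:%R *:%R cohom_tensV_fun.
Proof.
split=> [x a v v'|v a x x']; last exact: linearP.
apply: (cohom_ext (f := fmap h (tcomod_pure (a *: v + v') M))
  (g := (a \*: fmap h (tcomod_pure v M)) \+ fmap h (tcomod_pure v' M))) => m.
by rewrite tmap_lincombl -!theta_nat -linearP /= linearDl linearZl_LR.
Qed.
HB.instance Definition _ := bilinear_isBilinear.Build k V (h M) (h (tcomodule V M))
  *:%R *:%R cohom_tensV_fun cohom_tensV_bilinear.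
Definition cohom_tensV : {linear V ⊗ h M -> h (tcomodule V M)} := tlift cohom_tensV_fun.
Lemma cohom_tensVE v x : cohom_tensV (pure v x) = fmap h (tcomod_pure v M) x.
Proof. exact: tliftE. Qed.

Lemma cohom_tens_pure v x :
  cohom_tens qf V M (fmap h (tcomod_pure v M) x) = pure v x.
Proof.
apply: (cohom_ext (f := cohom_tens qf V M \o fmap h (tcomod_pure v M))
  (g := pure v : {linear _ -> _})) => m.
by rewrite tmap_compl -theta_nat cohom_tensP /= tmapE tmap_pure_idr.
Qed.

Lemma cohom_tensVK : cancel cohom_tensV (cohom_tens qf V M).
Proof.
apply: (tens_ext (f := cohom_tens qf V M \o cohom_tensV) (g := idl _)) => v x.
rewrite -[LHS]/(cohom_tens qf V M (cohom_tensV (pure v x))) cohom_tensVE.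
exact: cohom_tens_pure.
Qed.

Lemma cohom_tensK : cancel (cohom_tens qf V M) cohom_tensV.
Proof.
apply: (cohom_ext (f := cohom_tensV \o cohom_tens qf V M) (g := idl _)) => y.
rewrite tmap_id tmap_compl cohom_tensP.
apply: (tens_ext (f := tmap cohom_tensV (idl L) \o (tassocV \o tmap (idl V) (theta qf M)))
  (g := theta qf (tcomodule V M))) => v m.
rewrite [LHS]/= tmapE -tmap_pure_idr tmap_comp -[RHS]/(theta qf _ (tcomod_pure v M m)).
by rewrite theta_nat; apply: eq_tmap => // x /=; rewrite cohom_tensVE.
Qed.
End Inverse.

(** * The comparison of h(M) with M □ X *)

Local Notation X := (cohomC qf).
Local Notation Creg := (regular_comodule C).
Local Notation thetaC := (theta qf Creg).

(** The difference of ρ ⊗ C and M ⊗ Δ, whose kernel is M embedded by its coaction. Both comodules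
    coact through their last factor C, so that [cohom_tens] computes h on them. *)
Definition cobar M : comod_hom (tcomodule M Creg) (tcomodule (M ⊗ C) Creg) :=
  comod_sub (tcomod_mapl (rcoact M) Creg) (rcoact_hom (tcomodule M Creg)).

(** Under [cohom_tens], h carries [cobar] to the map with kernel M □ X. The first terms match by
    naturality in the vector space; the second ones match because the coaction of X is induced by
    Δ. *)
Lemma cohom_tens_cobar M t :
  tassoc (cohom_tens qf (M ⊗ C) Creg (fmap h (cobar M) t)) =
  cotensor_map X M (cohom_tens qf M Creg t).
Proof.
rewrite cohom_sub 2!linearB -[RHS]/(tassoc (tmap (rcoact M) (idl X) (cohom_tens qf M Creg t)) -
  tmap (idl M) (lcoact X) (cohom_tens qf M Creg t)).
congr (_ - _).
  congr (tassoc _).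
  apply: (cohom_ext
    (f := cohom_tens qf (M ⊗ C) Creg \o fmap h (tcomod_mapl (rcoact M) Creg))
    (g := tmap (rcoact M) (idl X) \o cohom_tens qf M Creg)) => y.
  rewrite [in LHS]tmap_compl [in RHS]tmap_compl -theta_nat !cohom_tensP -tassocV_natl.
  by rewrite /= tmap_lr.
apply: (cohom_ext
  (f := tassoc \o (cohom_tens qf (M ⊗ C) Creg \o fmap h (rcoact_hom (tcomodule M Creg))))
  (g := tmap (idl M) (lcoact X) \o cohom_tens qf M Creg)) => y.
rewrite 2!tmap_compl [in RHS]tmap_compl -theta_nat !cohom_tensP -tassocV_nat.
rewrite /= /tcoact /= -tassocV_natr tassocV_pentagon !tmap_comp; congr (tassocV _).
by apply: eq_tmap => // c /=; rewrite -cohomC_coactP.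
Qed.

(* An isomorphism onto M □ X. *)
Definition cohom_compare M : {linear h M -> M ⊗ X} :=
  cohom_tens qf M Creg \o fmap h (rcoact_hom M).

Lemma cohom_compareP M m : tmap (cohom_compare M) (idl L) (theta qf M m) =
  tassocV (tmap (idl M) thetaC (rcoact M m)).
Proof. by rewrite tmap_compl -theta_nat cohom_tensP. Qed.

Lemma cobar_rcoact M m : cobar M (rcoact_hom M m) = 0.
Proof. by rewrite /= /tcoact /= -rcoactA tassocK subrr. Qed.

Lemma cohom_compare_subproof M x : cotensor_map X M (cohom_compare M x) = 0.
Proof.
rewrite -[cohom_compare M x]/(cohom_tens qf M Creg (fmap h (rcoact_hom M) x)).
rewrite -cohom_tens_cobar -fmap_comp.
have -> : fmap h (comod_comp (cobar M) (rcoact_hom M)) x = 0; last by rewrite !linear0.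
apply: (cohom_ext (f := fmap h (comod_comp (cobar M) (rcoact_hom M))) (g := \0)) => m.
by rewrite -theta_nat -[comod_comp _ _ m]/(cobar M (rcoact_hom M m)) cobar_rcoact linear0 tmap0l.
Qed.

Definition cohom_cotensor M : {linear h M -> cotensor X M} :=
  ker_factor (@cohom_compare_subproof M).

Lemma cohom_cotensorE M x :
  cotensor_incl X M (cohom_cotensor M x) = cohom_compare M x.
Proof. by []. Qed.

Lemma cohom_cotensor_nat M N (f : comod_hom M N) x :
  cohom_cotensor N (fmap h f x) = cotensor_fmap X f (cohom_cotensor M x).
Proof.
apply: ker_incl_inj.
apply: (cohom_ext (f := cohom_compare N \o fmap h f)
  (g := tmap f (idl X) \o cohom_compare M)) => m.
rewrite [in LHS]tmap_compl [in RHS]tmap_compl -theta_nat !cohom_compareP.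
rewrite comod_funP -tassocV_natl; congr (tassocV _).
by rewrite tmap_lr.
Qed.

Hypothesis injL : injective_comodule L.

(** The counit retracts the coaction of M, which is therefore injective; h preserves this, and
    [cohom_tens] is bijective. *)
Lemma cohom_cotensor_inj M : injective (cohom_cotensor M).
Proof.
move=> x y /(congr1 (cotensor_incl X M)); rewrite !cohom_cotensorE.
move=> /(can_inj (@cohom_tensK _ _)); apply: cohom_injective => //.
by apply: (can_inj (g := trid \o tmap (idl M) (counit C))); apply: rcoact1.
Qed.

(** An element of M □ X corresponds to an element of h(M ⊗ C) killed by h([cobar]), which comes from
    h(M) by exactness. *)
Lemma cohom_cotensor_surj M z : exists x, cohom_cotensor M x = z.
Proof.
pose s : {linear tcomodule M Creg -> M} := trid \o tmap (idl M) (counit C).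
have sK m : s (rcoact_hom M m) = m by apply: rcoact1.
(* Exactness at M ⊗ C: where ρ ⊗ C and M ⊗ Δ agree, applying the counit to the last factor gives ρ(s
   n) = n. *)
have sP n : cobar M n = 0 -> rcoact_hom M (s n) = n.
  move=> /eqP; rewrite subr_eq0 => /eqP nP.
  rewrite -[LHS]/(rcoact M (trid (tmap (idl M) (counit C) n))) -trid_nat tmap_lr.
  rewrite -[tmap (rcoact M) _ n]/(tcomod_mapl (rcoact M) Creg n) nP.
  exact: (tcoact1 (V := M) (M := Creg)).
have [|x xP] := cohom_exact injL sK (@cobar_rcoact M) sP
  (t := cohom_tensV M Creg (cotensor_incl X M z)).
  apply: (can_inj (@cohom_tensK _ _)); apply: (can_inj (@tassocK _ _ _ _)).
  by rewrite cohom_tens_cobar cohom_tensVK (ker_inclP (f := cotensor_map X M)) !linear0.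
exists x; apply: ker_incl_inj.
by rewrite -[LHS]/(cohom_tens qf M Creg (fmap h (rcoact_hom M) x)) xP cohom_tensVK.
Qed.

End CohomTensor.

(** * Transport of the adjunction to - □ X *)

Lemma linear_inverse (k : fieldType) (V W : lmodType k) (f : {linear V -> W}) :
  injective f -> (forall w, exists v, f v = w) ->
  exists2 g : {linear W -> V}, cancel f g & cancel g f.
Proof.
move=> fI fS; have [r rP] := injective_retraction fI.
by exists r => // w; have [v <-] := fS w; rewrite rP.
Qed.

Lemma tlidVE (k : fieldType) (V : lmodType k) (v : V) : tlidV v = @pure k k^o V 1 v.
Proof. by []. Qed.

(** Coherence of the rebracketings of five factors that arise in comparing the comultiplications. *)
Lemma tassocV_pure_pure (k : fieldType) (V1 V2 V3 V4 V5 : lmodType k) (v1 : V1) (v2 : V2)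
    (r : V3 ⊗ (V4 ⊗ V5)) :
  tmap tassoc (idl V5) (tassocV (tmap tassocV (idl (V4 ⊗ V5))
    (tassocV (pure v1 (tassocV (pure v2 r)))))) =
  tassocV (pure (pure v1 v2) (tassocV r)).
Proof.
apply: (tens_ext3V (f := tmap tassoc (idl V5) \o (tassocV \o (tmap tassocV (idl (V4 ⊗ V5)) \o
    (tassocV \o ((pure v1 : {linear _ -> _}) \o (tassocV \o (pure v2 : {linear _ -> _})))))))
  (g := tassocV \o ((pure (pure v1 v2) : {linear _ -> _}) \o tassocV))) => v3 v4 v5 /=.
by rewrite !(tassocVE, tmapE, tassocE).
Qed.

Section CotensorCoalgebra.
Variables (k : fieldType) (C : coalgebra k) (L : rcomodule C) (qf : quasi_finite L).
Hypothesis injL : injective_comodule L.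
Implicit Types M N P : rcomodule C.
Local Notation h := (cohom qf).
Local Notation X := (cohomC qf).
Local Notation Creg := (regular_comodule C).
Local Notation thetaC := (theta qf Creg).
Local Notation phi := (cohom_cotensor qf).

(** An adjunction is data, so the inverse, known only to exist, is extracted by choice. *)
Definition cotensor_cohom_spec M :=
  cid2 (linear_inverse (cohom_cotensor_inj (qf := qf) injL (M := M)) (cohom_cotensor_surj injL (M := M))).
Definition cotensor_cohom M : {linear cotensor X M -> h M} := s2val (cotensor_cohom_spec M).
Lemma cohom_cotensorK M : cancel (phi M) (cotensor_cohom M).
Proof. exact: (s2valP (cotensor_cohom_spec M)). Qed.
Lemma cotensor_cohomK M : cancel (cotensor_cohom M) (phi M).
Proof. exact: (s2valP' (cotensor_cohom_spec M)). Qed.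

Lemma cotensor_cohom_nat M N (f : comod_hom M N) z :
  cotensor_cohom N (cotensor_fmap X f z) = fmap h f (cotensor_cohom M z).
Proof.
apply: (can_inj (@cohom_cotensorK N)).
by rewrite cotensor_cohomK cohom_cotensor_nat cotensor_cohomK.
Qed.

Definition cotensor_adj_unit M : comod_hom M (tcomodule (cotensor X M) L) :=
  comod_comp (tcomod_mapl (phi M) L) (theta qf M).
Definition cotensor_adj_counit (V : lmodType k) : {linear cotensor X (tcomodule V L) -> V} :=
  adj_counit (cohom_adj qf) V \o cotensor_cohom (tcomodule V L).

Definition cotensor_adjunction : adjunction (cotensor_functor X) L.
Proof.
exists cotensor_adj_unit cotensor_adj_counit => [M N f m|V W g x|M x|V y].
- rewrite /= theta_nat -!tmap_compl; apply: eq_tmap => // z.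
  exact: cohom_cotensor_nat.
- rewrite -[LHS]/(adj_counit (cohom_adj qf) W
    (cotensor_cohom _ (cotensor_fmap X (tcomod_mapl g L) x))).
  by rewrite cotensor_cohom_nat adj_counit_nat.
- rewrite -[LHS]/(adj_counit (cohom_adj qf) (cotensor X M)
    (cotensor_cohom _ (cotensor_fmap X (cotensor_adj_unit M) x))).
  rewrite cotensor_cohom_nat fmap_comp adj_counit_nat adj_triangle1.
  exact: cotensor_cohomK.
- rewrite /= -tmap_compl -[RHS](adj_triangle2 (cohom_adj qf)).
  by apply: eq_tmap => // x /=; rewrite cohom_cotensorK.
Defined.

Lemma cotensor_adjunction_unit M m :
  tassoc (tmap (cotensor_incl X M) (idl L) (adj_unit cotensor_adjunction M m)) =
  tmap (idl M) thetaC (rcoact M m).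
Proof.
apply: (can_inj (@tassocVK _ _ _ _)); rewrite tassocK -cohom_compareP /= -tmap_compl.
by apply: eq_tmap.
Qed.

(** * The coalgebra structure transported to L □ X *)

Definition cotensor_comul : {linear cotensor X L -> cotensor X L ⊗ cotensor X L} :=
  tmap (phi L) (phi L) \o (ecomul qf \o cotensor_cohom L).
Definition cotensor_counit : {linear cotensor X L -> k^o} := ecounit qf \o cotensor_cohom L.

Lemma cotensor_comulE x :
  cotensor_comul (phi L x) = tmap (phi L) (phi L) (ecomul qf x).
Proof.
rewrite -[LHS]/(tmap (phi L) (phi L) (ecomul qf (cotensor_cohom L (phi L x)))).
by rewrite cohom_cotensorK.
Qed.

Lemma cotensor_counitE x : cotensor_counit (phi L x) = ecounit qf x.
Proof. by rewrite -[LHS]/(ecounit qf (cotensor_cohom L (phi L x))) cohom_cotensorK. Qed.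

Lemma cotensor_is_coalgebra : is_coalgebra cotensor_comul cotensor_counit.
Proof.
have [eA el er] := e_is_coalgebra qf.
split=> z; rewrite -(cotensor_cohomK z) cotensor_comulE; set x := cotensor_cohom L z.
- rewrite tmap_comp.
  transitivity (tassoc (tmap (tmap (phi L) (phi L)) (phi L) (tmap (ecomul qf) (idl _) (ecomul qf x)))).
    by rewrite tmap_comp; congr (tassoc _); apply: eq_tmap => // y; apply: cotensor_comulE.
  rewrite tassoc_nat eA !tmap_comp.
  by apply: eq_tmap => // y; apply: esym (cotensor_comulE y).
- have := congr1 (phi L) (el x); rewrite tlid_nat => <-; rewrite !tmap_comp; congr (tlid _).
  by apply: eq_tmap => // y; apply: cotensor_counitE.
- have := congr1 (phi L) (er x); rewrite -trid_nat => <-; rewrite !tmap_comp; congr (trid _).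
  by apply: eq_tmap => // y; apply: cotensor_counitE.
Qed.

Lemma cotensor_counitP (V : lmodType k) t :
  adj_counit cotensor_adjunction V (tens_cotensor X V L t) =
  trid (tmap (idl V) cotensor_counit t).
Proof.
apply: (tens_ext (f := adj_counit cotensor_adjunction V \o tens_cotensor X V L)
  (g := trid \o tmap (idl V) cotensor_counit)) => v z.
rewrite -[RHS]/(trid (tmap (idl V) cotensor_counit (pure v z))) tmapE tridE.
rewrite -(cotensor_cohomK z); set x := cotensor_cohom L z.
rewrite cotensor_counitE.
have vE : tens_cotensor X V L (pure v (phi L x)) = phi _ (fmap h (tcomod_pure v L) x).
  rewrite cohom_cotensor_nat; apply: ker_incl_inj.
  by rewrite [LHS]/= tmapE /= tmap_pure_idr.
rewrite [LHS]/= [X in cotensor_cohom _ X]vE cohom_cotensorK.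
(* The map l ↦ v ⊗ l factors as L -> k ⊗ L -> V ⊗ L through a ↦ a v. Naturality of the counit then
   reduces the claim to V = k, where [ecounit] is defined. *)
pose u (a : k^o) : V := (a : k) *: v.
have ul : linear u by move=> a b c; rewrite /u scalerDl -scalerA.
pose U : {linear k^o -> V} := HB.pack u (GRing.isLinear.Build k k^o V *:%R u ul).
have -> : fmap h (tcomod_pure v L) x = fmap h (tcomod_mapl U L) (fmap h (tcomod_unit L) x).
  rewrite -fmap_comp; congr (fmap h _ x); apply: comod_hom_ext => l /=.
  by rewrite tlidVE tmapE /= /u scale1r.
by rewrite adj_counit_nat.
Qed.

(** By [cohom_compareP] this is theta at L followed by the comparison map on h(L), that is, the unit
    of the transported adjunction at L. *)
Definition cotensor_split : {linear L -> (L ⊗ X) ⊗ L} :=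
  tassocV \o (tmap (idl L) thetaC \o rcoact L).

(** Tested on theta, the left side becomes [cotensor_split] applied twice. Coassociativity of the
    coaction of L and colinearity of theta at C bring the right side to the same form. *)
Lemma cohom_compare_comul x :
  tmap (cohom_compare qf L) (cohom_compare qf L) (ecomul qf x) =
  tassoc (tmap cotensor_split (idl X) (cohom_compare qf L x)).
Proof.
apply: (cohom_ext (f := tmap (cohom_compare qf L) (cohom_compare qf L) \o ecomul qf)
  (g := tassoc \o (tmap cotensor_split (idl X) \o cohom_compare qf L))) => l.
rewrite [in LHS]tmap_compl ecomulP -tassocV_nat tmap_comp.
transitivity (tassocV (tmap (idl (L ⊗ X)) cotensor_split
    (tmap (cohom_compare qf L) (idl L) (theta qf L l)))).
  rewrite tmap_comp; congr (tassocV _); apply: eq_tmap => // m.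
  exact: cohom_compareP.
rewrite 2![in RHS]tmap_compl !cohom_compareP -tassocV_natl [in RHS]tmap_comp.
pose S : {linear L ⊗ C -> (L ⊗ X) ⊗ L} := tassocV \o tmap (idl L) thetaC.
have -> : tmap (cotensor_split \o idl L) (idl (X ⊗ L) \o thetaC) (rcoact L l) =
    tmap S thetaC (tassocV (tmap (idl L) (comul C) (rcoact L l))).
  by rewrite -rcoactA tassocK tmap_comp; apply: eq_tmap.
(* Both sides are now linear in the coaction of l, so it may be replaced by an elementary tensor m ⊗
   c. *)
move: (rcoact L l); apply: (tens_ext
  (f := tassocV \o (tmap (idl _) cotensor_split \o (tassocV \o tmap (idl L) thetaC)))
  (g := tmap tassoc (idl L) \o (tassocV \o
          (tmap S thetaC \o (tassocV \o tmap (idl L) (comul C)))))) => m c.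
rewrite [LHS]/= [RHS]/= !tmapE.
(* Colinearity of theta at C turns Δ(c) into the coaction of L on the second factor of [thetaC c].
   Both sides then depend linearly on [thetaC c]. *)
have -> : tmap S thetaC (tassocV (pure m (comul C c))) =
    tmap tassocV (idl _) (tassocV (pure m (tassocV
      (tmap (idl X) (tmap (idl L) thetaC \o rcoact L) (thetaC c))))).
  transitivity (tmap tassocV (idl (X ⊗ L)) (tassocV (tmap (idl L) (tmap thetaC thetaC)
      (pure m (comul C c))))).
    rewrite tassocV_nat tmap_comp; exact: eq_tmap.
  rewrite tmapE; congr (tmap _ _ (tassocV (pure _ _))).
  rewrite tmap_compr tassocV_natr.
  rewrite -[tassocV (tmap _ _ _)]/(rcoact (tcomodule X L) (thetaC c)) comod_funP tmap_comp.
  exact: eq_tmap.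
apply: (tens_ext
  (f := tassocV \o (tmap (idl _) cotensor_split \o (tassocV \o (pure m : {linear _ -> _}))))
  (g := tmap tassoc (idl L) \o (tassocV \o (tmap tassocV (idl _) \o
          (tassocV \o ((pure m : {linear _ -> _}) \o (tassocV \o
            tmap (idl X) (tmap (idl L) thetaC \o rcoact L)))))))) => x' m'.
by rewrite [LHS]/= [RHS]/= [in RHS]tmapE tassocV_pure_pure tassocVE tmapE.
Qed.

Lemma cotensor_comulP z :
  tmap (cotensor_incl X L) (cotensor_incl X L) (cotensor_comul z) =
  tassoc (tmap (@tassocV _ L X L) (idl X)
    (tmap (tmap (idl L) thetaC) (idl X) (tmap (rcoact L) (idl X) (cotensor_incl X L z)))).
Proof.
rewrite -(cotensor_cohomK z); set x := cotensor_cohom L z.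
rewrite cotensor_comulE tmap_comp cohom_cotensorE -!tmap_compl.
exact: cohom_compare_comul.
Qed.

Definition cotensor_coalgebra_of_injective : cotensor_coalgebra qf :=
  CotensorCoalgebra cotensor_is_coalgebra cotensor_comulP cotensor_adjunction_unit
    cotensor_counitP.

End CotensorCoalgebra.

Theorem corollary3p1p5 (k : fieldType) (C : coalgebra k) (L : rcomodule C)
    (qf : quasi_finite L) (injL : injective_comodule L) :
  exists D : cotensor_coalgebra qf, coalgebra_iso (e_coalgebra qf) D.
Proof.
exists (cotensor_coalgebra_of_injective qf injL), (cohom_cotensor qf L); split.
- by exists (cotensor_cohom qf injL L); [apply: cohom_cotensorK|apply: cotensor_cohomK].
- exact: cotensor_comulE.
- exact: cotensor_counitE.
Qed.
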